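(* Let $A$ be a uniform algebra and let $\theta : A \to M_n(\mathbb{C})$ be a continuous unital homomorphism. If $\|\theta\| > 1$, then for every continuous linear functional $\beta$ on $A$, $$\|\theta + \beta I\| \ge \|\theta\|,$$ where $\theta+\beta I : A\to M_n(\mathbb{C})$ denotes the linear map $f \mapsto \theta(f)+\beta(f)I$.
   Context: A uniform algebra is a norm-closed subalgebra of $C(X)$, for $X$ a compact Hausdorff space, containing the constants, with the supremum norm. $M_n(\mathbb{C})$ carries the operator norm, and norms of maps are operator norms. *)

(* Defs.v *)
From HB Require Import structures.
From mathcomp Require Import all_boot all_order all_algebra.
From mathcomp Require Import all_classical all_reals all_analysis.
From mathcomp Require Import complex.
Set Implicit Arguments. Unset Strict Implicit. Unset Printing Implicit Defensive.
Import Order.TTheory GRing.Theory Num.Theory.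
Import numFieldNormedType.Exports.
Local Open Scope classical_set_scope.
Local Open Scope ring_scope.

Section Defs.
Variable R : realType.
Local Notation C := R[i].

Definition cmod (z : C) : R := Num.sqrt (complex.Re z ^+ 2 + complex.Im z ^+ 2).

(* supremum norm of f : X -> C (X compact, so finite for continuous f) *)
Definition supnorm (X : Type) (f : X -> C) : \bar R :=
  ereal_sup [set (cmod (f x))%:E | x in [set: X]].

Definition vnorm (n : nat) (v : 'cV[C]_n) : R :=
  Num.sqrt (\sum_(i < n) cmod (v i ord0) ^+ 2).

Definition mxopnorm (n : nat) (M : 'M[C]_n) : \bar R :=
  ereal_sup [set (vnorm (M *m v))%:E | v in [set v : 'cV[C]_n | vnorm v <= 1]].

Definition mapnorm (X : Type) (A : set (X -> C)) (n : nat)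
    (Phi : (X -> C) -> 'M[C]_n) : \bar R :=
  ereal_sup [set mxopnorm (Phi f) | f in [set f | A f /\ (supnorm f <= 1%:E)%E]].

Definition uniform_algebra (X : topologicalType) (A : set (X -> C)) : Prop :=
  hausdorff_space X /\ compact [set: X] /\
  (forall f, A f -> continuous (f : X -> C^o)) /\
  (forall c : C, A (fun _ => c)) /\
  (forall f g, A f -> A g -> A (fun x => f x + g x)) /\
  (forall (c : C) f, A f -> A (fun x => c * f x)) /\
  (forall f g, A f -> A g -> A (fun x => f x * g x)) /\
  (forall g : X -> C, continuous (g : X -> C^o) ->
     (forall e : R, 0 < e -> exists f, A f /\
        (supnorm (fun x => (f x - g x)%R) < e%:E)%E) -> A g).

Definition unital_hom (X : Type) (A : set (X -> C)) (n : nat)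
    (theta : (X -> C) -> 'M[C]_n) : Prop :=
  [/\ (forall f g, A f -> A g -> theta (fun x => f x + g x) = theta f + theta g),
      (forall (c : C) f, A f -> theta (fun x => c * f x) = c *: theta f),
      (forall f g, A f -> A g -> theta (fun x => f x * g x) = theta f *m theta g) &
      theta (fun _ => 1) = 1%:M].

Definition mx_continuous_on (X : Type) (A : set (X -> C)) (n : nat)
    (theta : (X -> C) -> 'M[C]_n) : Prop :=
  forall f, A f -> forall e : R, 0 < e -> exists2 d : R, 0 < d &
    forall g, A g -> (supnorm (fun x => (g x - f x)%R) < d%:E)%E ->
      (mxopnorm (theta g - theta f)%R < e%:E)%E.

Definition cont_lin_functional (X : Type) (A : set (X -> C))
    (beta : (X -> C) -> C) : Prop :=
  [/\ (forall f g, A f -> A g -> beta (fun x => f x + g x) = beta f + beta g),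
      (forall (c : C) f, A f -> beta (fun x => c * f x) = c * beta f) &
      (forall f, A f -> forall e : R, 0 < e -> exists2 d : R, 0 < d &
        forall g, A g -> (supnorm (fun x => (g x - f x)%R) < d%:E)%E ->
          cmod (beta g - beta f) < e)].

End Defs.

(* Main.v *)
(* If [T = theta f] and the unit vector [v] nearly attain [K = |theta| > 1],
   then [<T v, v>] is nearly [0]: applying [theta] to (an approximation of) the
   Moebius transform [(f - a) / (1 - conj a f)] gives
   [|(T - a) v|^2 <= K^2 |(1 - conj a T) v|^2 + O(|a|^2)], and comparing the
   terms linear in [a] bounds [(K^2 - 1) Re (conj a <T v, v>)] by
   [K^2 - |T v|^2 + O(|a|^2)].  Hence [|(T + b) v|^2], with its cross term
   [2 Re (conj b <T v, v>)], cannot fall much below [|T v|^2]. *)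
Require Import Defs.
From HB Require Import structures.
From mathcomp Require Import all_boot all_order all_algebra.
From mathcomp Require Import all_classical all_reals all_analysis.
From mathcomp Require Import complex.
From mathcomp Require Import ring lra.
Import Order.TTheory GRing.Theory Num.Theory.
Import numFieldNormedType.Exports.
Local Open Scope classical_set_scope.
Local Open Scope ring_scope.
Set Implicit Arguments. Unset Strict Implicit. Unset Printing Implicit Defensive.

(** * Squared moduli, the real inner product on C^n, and two scalar estimates *)

Section RealInnerProduct.
Variable R : realType.
Local Notation C := R[i].

(** Squared moduli with values in [R] keep square roots out of the estimates, which become
    polynomial inequalities over the reals. *)
Definition normsq (z : C) : R := complex.Re z ^+ 2 + complex.Im z ^+ 2.

Lemma normsq_ge0 (z : C) : 0 <= normsq z.
Proof. by rewrite addr_ge0 ?sqr_ge0. Qed.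

Lemma cmodE (z : C) : cmod z = Num.sqrt (normsq z).
Proof. by []. Qed.

Lemma cmod_sqr (z : C) : cmod z ^+ 2 = normsq z.
Proof. by rewrite cmodE sqr_sqrtr // normsq_ge0. Qed.

Lemma cmod_ge0 (z : C) : 0 <= cmod z.
Proof. exact: sqrtr_ge0. Qed.

Lemma normsqM (w z : C) : normsq (w * z) = normsq w * normsq z.
Proof. by case: w z => [a b] [c d]; rewrite /normsq /=; ring. Qed.

Lemma normsq_conj (z : C) : normsq (conjc z) = normsq z.
Proof. by case: z => [a b]; rewrite /normsq /=; ring. Qed.

Lemma normsq_real (r : R) : normsq r%:C%C = r ^+ 2.
Proof. by rewrite /normsq /=; ring. Qed.

Lemma cmodM (w z : C) : cmod (w * z) = cmod w * cmod z.
Proof. by rewrite !cmodE normsqM sqrtrM // normsq_ge0. Qed.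

Lemma cmod_real (r : R) : 0 <= r -> cmod r%:C%C = r.
Proof. by move=> r0; rewrite cmodE normsq_real sqrtr_sqr ger0_norm. Qed.

Lemma cmod_le (z : C) (r : R) : 0 <= r -> (cmod z <= r) = (normsq z <= r ^+ 2).
Proof.
by move=> r0; rewrite -cmod_sqr ler_sqr ?nnegrE // cmod_ge0.
Qed.

Section Dot.
Variable n : nat.
Implicit Types u v w : 'cV[C]_n.

(* The real part of the Hermitian inner product. *)
Definition rdot u v : R :=
  \sum_(i < n) (complex.Re (u i ord0) * complex.Re (v i ord0)
              + complex.Im (u i ord0) * complex.Im (v i ord0)).

Lemma rdotC u v : rdot u v = rdot v u.
Proof. by apply: eq_bigr => i _; ring. Qed.

Lemma rdotDr u v w : rdot u (v + w) = rdot u v + rdot u w.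
Proof.
rewrite -big_split; apply: eq_bigr => i _ /=; rewrite mxE.
by case: (v i ord0) (w i ord0) => [a b] [c d] /=; ring.
Qed.

Lemma rdotNr u v : rdot u (- v) = - rdot u v.
Proof.
rewrite -sumrN; apply: eq_bigr => i _ /=; rewrite mxE.
by case: (v i ord0) => [a b] /=; ring.
Qed.

Lemma rdotr0 u : rdot u 0 = 0.
Proof. by rewrite /rdot big1 // => i _; rewrite mxE /= !mulr0 addr0. Qed.

Lemma rdotDl u v w : rdot (u + v) w = rdot u w + rdot v w.
Proof. by rewrite rdotC rdotDr !(rdotC w). Qed.

Lemma rdotNl u v : rdot (- u) v = - rdot u v.
Proof. by rewrite rdotC rdotNr rdotC. Qed.

Lemma rdotZr (a : C) u v : rdot u (a *: v) = rdot (conjc a *: u) v.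
Proof.
apply: eq_bigr => i _ /=; rewrite !mxE.
by case: a (u i ord0) (v i ord0) => [a b] [c d] [e f] /=; ring.
Qed.

Lemma rdotZZ (a : C) u v : rdot (a *: u) (a *: v) = normsq a * rdot u v.
Proof.
rewrite mulr_sumr; apply: eq_bigr => i _ /=; rewrite !mxE /normsq.
by case: a (u i ord0) (v i ord0) => [a b] [c d] [e f] /=; ring.
Qed.

Lemma rdotZr_real (r : R) u v : rdot u (r%:C%C *: v) = r * rdot u v.
Proof.
rewrite mulr_sumr; apply: eq_bigr => i _ /=; rewrite !mxE.
by case: (u i ord0) (v i ord0) => [c d] [e f] /=; ring.
Qed.

Lemma rdot_sqE v : rdot v v = \sum_(i < n) normsq (v i ord0).
Proof. by apply: eq_bigr => i _; rewrite /normsq !expr2. Qed.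

Lemma rdot_ge0 v : 0 <= rdot v v.
Proof. by rewrite rdot_sqE sumr_ge0 // => i _; rewrite normsq_ge0. Qed.

Lemma rdot_eq0 v : rdot v v = 0 -> v = 0.
Proof.
rewrite rdot_sqE => /eqP; rewrite psumr_eq0 => [/allP v0|i _]; last exact: normsq_ge0.
apply/matrixP => i j; rewrite ord1 mxE.
have := v0 i (mem_index_enum i).
rewrite implyTb /normsq paddr_eq0 ?sqr_ge0 // !sqrf_eq0 => /andP[].
by case: (v i ord0) => a b /= /eqP -> /eqP ->.
Qed.

Lemma rdot_le u v : 2 * rdot u v <= rdot u u + rdot v v.
Proof.
have := rdot_ge0 (u - v); rewrite !(rdotDl, rdotDr, rdotNl, rdotNr) (rdotC v u).
lra.
Qed.

Lemma rdot_sub_le u v : rdot (u - v) (u - v) <= 2 * (rdot u u + rdot v v).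
Proof.
have := rdot_le u (- v); rewrite !(rdotDl, rdotDr, rdotNl, rdotNr) (rdotC v u).
lra.
Qed.

Lemma rdot_sqD u v : rdot (u + v) (u + v) = rdot u u + 2 * rdot u v + rdot v v.
Proof. by rewrite !(rdotDl, rdotDr) (rdotC v u); ring. Qed.

Lemma vnormE v : vnorm v = Num.sqrt (rdot v v).
Proof.
by rewrite rdot_sqE /vnorm; under eq_bigr do rewrite cmod_sqr.
Qed.

Lemma vnorm_ge0 v : 0 <= vnorm v.
Proof. exact: sqrtr_ge0. Qed.

Lemma vnorm_sqr v : vnorm v ^+ 2 = rdot v v.
Proof. by rewrite vnormE sqr_sqrtr // rdot_ge0. Qed.

Lemma vnorm_le v (r : R) : 0 <= r -> (vnorm v <= r) = (rdot v v <= r ^+ 2).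
Proof. by move=> r0; rewrite -vnorm_sqr ler_sqr ?nnegrE // vnorm_ge0. Qed.

Lemma vnorm_lt v (r : R) : 0 <= r -> (r < vnorm v) = (r ^+ 2 < rdot v v).
Proof. by move=> r0; rewrite -vnorm_sqr ltr_sqr ?nnegrE // vnorm_ge0. Qed.

Lemma vnormZ (a : C) v : vnorm (a *: v) = cmod a * vnorm v.
Proof. by rewrite !vnormE rdotZZ sqrtrM // normsq_ge0. Qed.

End Dot.

(* To first order in [a], [w - a + conj a * w^2] is the disc automorphism
   [(w - a) / (1 - conj a * w)]. *)
Lemma normsq_moebius_approx (a w : C) : normsq w <= 1 ->
  normsq (w - a + conjc a * (w * w)) <= 1 + 5 * normsq a.
Proof.
case: a w => [a b] [c d]; rewrite /normsq /= => w1.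
(* In complex terms [p] is Re(conj a w), [m] is |w|^2 and [t] is |a|^2. *)
set p := a * c + b * d.
set m := c ^+ 2 + d ^+ 2 in w1 *.
set t := a ^+ 2 + b ^+ 2.
have m0 : 0 <= m by rewrite addr_ge0 ?sqr_ge0.
have t0 : 0 <= t by rewrite addr_ge0 ?sqr_ge0.
have p2 : p ^+ 2 <= t * m.
  have -> : t * m = p ^+ 2 + (a * d - b * c) ^+ 2 by rewrite /t /m /p; ring.
  by rewrite lerDl sqr_ge0.
have pp : - 2 * p <= 1 + p ^+ 2 by have := sqr_ge0 (p + 1); rewrite sqrrD; lra.
(* The left side is the exact expansion of the squared modulus. The constant 5 is 4 + 1:
   [t * (1 + m) ^+ 2] costs at most [4 * t], and [(1 - m) * p ^+ 2] at most [t]. *)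
suff : m - 2 * (1 - m) * p + t * (1 + m) ^+ 2 - 4 * p ^+ 2 <= 1 + 5 * t.
  by congr (_ <= _); rewrite /m /p /t; ring.
have : (1 - m) * (- 2 * p) <= (1 - m) * (1 + p ^+ 2) by rewrite ler_wpM2l // subr_ge0.
have : (1 - m) * p ^+ 2 <= (1 - m) * (t * m) by rewrite ler_wpM2l // subr_ge0.
have : t * (m * (1 - m)) <= t * 1 by rewrite ler_wpM2l //; nra.
have : t * (1 + m) ^+ 2 <= t * 4 by rewrite ler_wpM2l //; nra.
have := sqr_ge0 p; lra.
Qed.

(** The scalar end of [extremal_ineq], where [t] is |a|^2, [P] is Re<Tv, av>, [y] is |(1 - conj a
    T)v|^2, [w] is |Tv - av|^2, [q] and [q3] are |Tv|^2 and |T^3 v|^2, and [x], [r] come from the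
    remainder. The sharp bounds on [y] and [w] keep the term linear in [P]; the crude ones serve
    where a factor [t] is already present. *)
Lemma extremal_arith (k t P y w q q3 x r : R) : 0 <= k -> 0 <= t ->
  y <= 1 - 2 * P + t * k -> y <= 2 * (1 + k) ->
  q - 2 * P <= w -> w <= 2 * (1 + k) -> q <= k -> q3 <= k ^+ 3 -> 0 <= r ->
  - (t * (2 * w + q + q3)) <= x -> w + x + r <= k * (1 + 5 * t) * y ->
  2 * (k - 1) * P <= k - q + (k ^+ 3 + 11 * k ^+ 2 + 15 * k + 4) * t.
Proof.
move=> k0 t0 y1 y2 w1 w2 qk q3k r0 xt h.
have {}y1 := ler_wpM2l k0 y1.
have {}y2 := ler_wpM2l (mulr_ge0 t0 k0) y2.
have {}w2 := ler_wpM2l t0 w2.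
have {}qk := ler_wpM2l t0 qk.
have {}q3k := ler_wpM2l t0 q3k.
lra.
Qed.

End RealInnerProduct.

(** * Pointwise forms of the supremum, operator and map norms *)

Section Norms.
Variable R : realType.
Local Notation C := R[i].

Lemma supnorm_le (X : Type) (f : X -> C) (r : R) :
  (supnorm f <= r%:E)%E <-> forall x, cmod (f x) <= r.
Proof.
split=> [h x|h].
  by rewrite -lee_fin; apply: (le_trans _ h); apply: ereal_sup_ubound; exists x.
by apply: ge_ereal_sup => _ [x _ <-]; rewrite lee_fin.
Qed.

Lemma mxopnorm_ub n (M : 'M[C]_n) (v : 'cV[C]_n) :
  vnorm v <= 1 -> ((vnorm (M *m v))%:E <= mxopnorm M)%E.
Proof. by move=> v1; apply: ereal_sup_ubound; exists v. Qed.

Lemma mapnorm_ub (X : Type) (A : set (X -> C)) n (Phi : (X -> C) -> 'M[C]_n)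
    (f : X -> C) (v : 'cV[C]_n) :
  A f -> (supnorm f <= 1%:E)%E -> vnorm v <= 1 ->
  ((vnorm (Phi f *m v))%:E <= mapnorm A Phi)%E.
Proof.
move=> Af f1 v1; apply: le_trans (mxopnorm_ub _ v1) _.
by apply: ereal_sup_ubound; exists f.
Qed.

Lemma mapnorm_le (X : Type) (A : set (X -> C)) n (Phi : (X -> C) -> 'M[C]_n)
    (y : \bar R) :
  (forall f v, A f -> (supnorm f <= 1%:E)%E -> vnorm v <= 1 ->
    ((vnorm (Phi f *m v))%:E <= y)%E) -> (mapnorm A Phi <= y)%E.
Proof.
move=> h; apply: ge_ereal_sup => _ [f [Af f1] <-].
by apply: ge_ereal_sup => _ [v v1 <-]; exact: h.
Qed.

Lemma mapnorm_gt (X : Type) (A : set (X -> C)) n (Phi : (X -> C) -> 'M[C]_n)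
    (y : \bar R) : (y < mapnorm A Phi)%E ->
  exists f v, [/\ A f, (supnorm f <= 1%:E)%E, vnorm v <= 1 &
    (y < (vnorm (Phi f *m v))%:E)%E].
Proof.
move=> /ereal_sup_gt[_ [f [Af f1] <-]] /ereal_sup_gt[_ [v v1 <-]] yv.
by exists f, v.
Qed.

End Norms.

(** * Estimates for a unital homomorphism of norm K *)

Section Homomorphism.
Variables (R : realType) (X : topologicalType) (A : set (X -> R[i])) (n : nat).
Variable theta : (X -> R[i]) -> 'M[R[i]]_n.
Hypotheses (algA : uniform_algebra A) (homt : unital_hom A theta).
Local Notation C := R[i].

Lemma algC (c : C) : A (fun=> c).
Proof. by case: algA => _ [_ [_ [h _]]]; exact: h. Qed.

Lemma algD f g : A f -> A g -> A (fun x => f x + g x).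
Proof. by case: algA => _ [_ [_ [_ [h _]]]]; exact: h. Qed.

Lemma algZ (c : C) f : A f -> A (fun x => c * f x).
Proof. by case: algA => _ [_ [_ [_ [_ [h _]]]]]; exact: h. Qed.

Lemma algM f g : A f -> A g -> A (fun x => f x * g x).
Proof. by case: algA => _ [_ [_ [_ [_ [_ [h _]]]]]]; exact: h. Qed.

Lemma homC (c : C) : theta (fun=> c) = c%:M.
Proof.
case: homt => _ hZ _ h1; have := hZ c _ (algC 1).
by rewrite h1 scalemx1 => <-; congr theta; apply/funext => x; rewrite mulr1.
Qed.

(** Continuity at 0 with tolerance 1 gives a radius [d]; shrinking the unit ball by [d / 2] puts it
    inside that radius, whence the bound [2 / d]. *)
Lemma mapnorm_lty : mx_continuous_on A theta -> (mapnorm A theta < +oo)%E.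
Proof.
case: homt => _ hZ _ _ /(_ _ (algC 0) 1 ltr01)[d d0 hd].
apply: (@le_lt_trans _ _ (2 / d)%:E); last exact: ltry.
apply: mapnorm_le => f v Af /supnorm_le f1 v1; rewrite lee_fin.
have d2 : 0 <= d / 2 by rewrite divr_ge0 // ltW.
have : (supnorm (fun x => (d / 2)%:C%C * f x - 0)%R < d%:E)%E.
  apply: (@le_lt_trans _ _ (d / 2)%:E); last by rewrite lte_fin; lra.
  apply/supnorm_le => x; rewrite subr0 cmodM cmod_real //.
  by rewrite ler_piMr.
move=> /(hd _ (algZ (d / 2)%:C%C Af)); rewrite homC raddf0 subr0 hZ // => hlt.
have := le_lt_trans (mxopnorm_ub _ v1) hlt.
rewrite lte_fin -scalemxAl vnormZ cmod_real // => /ltW.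
by rewrite -ler_pdivlMl ?divr_gt0 // invf_div mulr1.
Qed.

Variable K : R.
Hypothesis normK : mapnorm A theta = K%:E.

Lemma hom_bound h (v : 'cV[C]_n) (m : R) : A h -> 0 < m ->
  (forall x, normsq (h x) <= m) ->
  rdot (theta h *m v) (theta h *m v) <= K ^+ 2 * m * rdot v v.
Proof.
move=> Ah m0 hm; have [_ hZ _ _] := homt.
(* The zero vector cannot be normalised and is treated apart. *)
have [v0|v0] := eqVneq (rdot v v) 0.
  by rewrite (rdot_eq0 v0) mulmx0 !rdotr0 mulr0.
have q0 : 0 < rdot v v by rewrite lt0r v0 rdot_ge0.
pose r := (Num.sqrt m)^-1; pose s := (Num.sqrt (rdot v v))^-1.
have r0 : 0 <= r by rewrite invr_ge0 sqrtr_ge0.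
have s0 : 0 <= s by rewrite invr_ge0 sqrtr_ge0.
have r2 : r ^+ 2 = m^-1 by rewrite exprVn sqr_sqrtr // ltW.
have s2 : s ^+ 2 = (rdot v v)^-1 by rewrite exprVn sqr_sqrtr // ltW.
have r1 : (supnorm (fun x => r%:C%C * h x)%R <= 1%:E)%E.
  apply/supnorm_le => x; rewrite cmod_le // normsqM normsq_real r2 expr1n.
  by rewrite -ler_pdivlMl ?invr_gt0 // invrK mulr1.
have s1 : vnorm (s%:C%C *: v) <= 1.
  by rewrite vnorm_le // rdotZZ normsq_real s2 mulVf // expr1n.
have := mapnorm_ub theta (algZ r%:C%C Ah) r1 s1.
rewrite normK lee_fin hZ // => hK.
have K0 : 0 <= K by apply: (le_trans _ hK); exact: vnorm_ge0.
move: hK; rewrite vnorm_le // -scalemxAl -scalemxAr !rdotZZ !normsq_real r2 s2.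
have -> : K ^+ 2 * m * rdot v v = rdot v v * (m * K ^+ 2) by ring.
by rewrite !ler_pdivrMl.
Qed.

Let k := K ^+ 2.
Let c := k ^+ 3 + 11 * k ^+ 2 + 15 * k + 4.

(* [T := theta f] satisfies [g(T)(1 - conj a T) = T - a + O(|a|^2)] for
   [g = f - a + conj a f^2], whose norm is at most [sqrt (1 + 5 |a|^2)]. *)
Lemma extremal_ineq f (v : 'cV[C]_n) (a : C) :
  A f -> (supnorm f <= 1%:E)%E -> vnorm v <= 1 -> normsq a <= 1 ->
  2 * (k - 1) * rdot (theta f *m v) (a *: v) <=
    k - rdot (theta f *m v) (theta f *m v) + c * normsq a.
Proof.
have [hD hZ hM _] := homt.
move=> Af /supnorm_le f1; rewrite vnorm_le // expr1n => v1 a1.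
have {}f1 x : normsq (f x) <= 1 by have := f1 x; rewrite cmod_le // expr1n.
set t := normsq a in a1 *; have t0 : 0 <= t := normsq_ge0 a.
have fbound w : rdot (theta f *m w) (theta f *m w) <= k * rdot w w.
  by have := hom_bound w Af ltr01 f1; rewrite mulr1.
set Tv := theta f *m v; set T3v := theta f *m (theta f *m Tv).
pose g x := f x - a + conjc a * (f x * f x).
have A1 : A (fun x => f x - a) := algD Af (algC (- a)).
have A2 : A (fun x => conjc a * (f x * f x)) := algZ _ (algM Af Af).
have Ag : A g := algD A1 A2.
have thg : theta g = theta f - a%:M + conjc a *: (theta f *m theta f).
  have -> : theta g =
      theta (fun x => f x - a) + theta (fun x => conjc a * (f x * f x)).
    exact: hD.
  have -> : theta (fun x => f x - a) = theta f + theta (fun=> - a).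
    exact: (hD f (fun=> - a) Af (algC _)).
  rewrite homC raddfN; congr (_ + _).
  by rewrite (hZ _ (fun x => f x * f x)) ?hM //; exact: algM.
pose y := v - conjc a *: Tv.
(* In [(T - a + conj a T^2)(1 - conj a T)v] the two terms in [T^2] cancel, so this remainder is
   exact. *)
pose r := t%:C%C *: Tv - conjc a *: (conjc a *: T3v).
have gy : theta g *m y = Tv - a *: v + r.
  rewrite thg mulmxDl mulmxBl mul_scalar_mx -scalemxAl -mulmxA /y.
  rewrite !mulmxBr -!scalemxAr -/Tv -/T3v !scalerBr !scalerA.
  have -> : a * conjc a = t%:C%C.
    by rewrite /t /normsq; case: (a) => p q /=; congr Complex; ring.
  rewrite /r scalerA; move: (_ *: v) (_ *: Tv) (_ *: (theta f *m Tv)) (_ *: T3v).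
  move=> w1 w2 w3 w4.
  by apply/matrixP => i j; rewrite !mxE; ring.
have m0 : 0 < 1 + 5 * t by lra.
have := hom_bound y Ag m0 (fun x => normsq_moebius_approx _ (f1 x)).
rewrite -/k gy; set w := Tv - a *: v.
have k0 : 0 <= k := sqr_ge0 K.
have Tv1 : rdot Tv Tv <= k by apply: le_trans (fbound v) _; rewrite ler_piMr.
have T3v1 : rdot T3v T3v <= k ^+ 3.
  have h1 := fbound (theta f *m Tv); have h2 := fbound Tv; rewrite -/T3v in h1.
  apply: le_trans h1 _; rewrite exprS ler_wpM2l //.
  by apply: le_trans h2 _; rewrite expr2 ler_wpM2l.
set P := rdot Tv (a *: v).
have yy : rdot y y = rdot v v - 2 * P + t * rdot Tv Tv.
  rewrite /y !(rdotDl, rdotDr, rdotNl, rdotNr) (rdotC (conjc a *: Tv) v).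
  have -> : rdot v (conjc a *: Tv) = P by rewrite rdotZr conjcK rdotC.
  rewrite rdotZZ normsq_conj -/t; ring.
have ww : rdot w w = rdot Tv Tv - 2 * P + t * rdot v v.
  by rewrite /w !(rdotDl, rdotDr, rdotNl, rdotNr) rdotZZ -/t (rdotC (a *: v)) -/P; ring.
have wle : rdot w w <= 2 * (rdot Tv Tv + t * rdot v v).
  by rewrite /t -rdotZZ; exact: rdot_sub_le.
have yle : rdot y y <= 2 * (rdot v v + t * rdot Tv Tv).
  apply: le_trans (rdot_sub_le _ _) _; by rewrite rdotZZ normsq_conj.
(* Moving one factor [conjc a] across the inner product leaves a factor of modulus |a| on each side,
   so the [T3v] term is also of order [t]. *)
have wr u : - (t * (2 * rdot u u + rdot Tv Tv + rdot T3v T3v)) <= 2 * rdot u r.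
  rewrite /r rdotDr rdotNr rdotZr_real rdotZr conjcK.
  have h1 := rdot_le (- u) Tv; rewrite !(rdotNl, rdotNr) in h1.
  have h2 := rdot_le (a *: u) (conjc a *: T3v); rewrite !rdotZZ normsq_conj -/t in h2.
  have := ler_wpM2l t0 h1; lra.
rewrite rdot_sqD => H; have {}wr := wr w.
have r0 := rdot_ge0 r; have v0 := rdot_ge0 v.
have Tt : t * rdot Tv Tv <= t * k by rewrite ler_wpM2l.
have tv : 0 <= t * rdot v v by rewrite mulr_ge0.
have tk : t * k <= k by rewrite ler_piMl.
have tv1 : t * rdot v v <= 1 by rewrite mulr_ile1.
have y1 : rdot y y <= 1 - 2 * P + t * k by rewrite yy !lerD.
have y2 : rdot y y <= 2 * (1 + k).
  by apply: le_trans yle _; rewrite ler_wpM2l // lerD // (le_trans Tt).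
have w2 : rdot w w <= 2 * (1 + k).
  by apply: le_trans wle _; rewrite ler_wpM2l // addrC lerD.
have w1 : rdot Tv Tv - 2 * P <= rdot w w by rewrite ww lerDl.
exact: (extremal_arith k0 t0 y1 y2 w1 w2 Tv1 T3v1 r0 wr H).
Qed.

(** The factor of the defect [k - |Tv|^2] depends on [k] alone. The bound is thus uniform in [b],
    which may be [beta f] for an [f] chosen as nearly extremal as desired. *)
Lemma perturbed_ge f (v : 'cV[C]_n) (b : C) : 1 < k ->
  A f -> (supnorm f <= 1%:E)%E -> vnorm v <= 1 ->
  1 <= rdot (theta f *m v) (theta f *m v) ->
  rdot (theta f *m v) (theta f *m v)
    - c * k / (k - 1) ^+ 2 * (k - rdot (theta f *m v) (theta f *m v))
  <= rdot (theta f *m v + b *: v) (theta f *m v + b *: v).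
Proof.
move=> k1 Af f1 v1; set N := rdot _ _; set M := rdot _ _ => N1.
have k0 : 0 < k by lra.
have k10 : 0 < k - 1 by lra.
have c0 : 2 * (k - 1) <= c.
  have k2 := sqr_ge0 k; have k3 : 0 <= k ^+ 3 by rewrite exprn_ge0 // ltW.
  rewrite /c; lra.
have c00 : 0 < c by lra.
have Nk : N <= k * rdot v v.
  have := hom_bound v Af ltr01 _; rewrite mulr1; apply=> x.
  by move/supnorm_le: f1 => /(_ x); rewrite cmod_le // expr1n.
have vv1 : rdot v v <= 1 by move: v1; rewrite vnorm_le // expr1n.
have Nk' : N <= k by apply: le_trans Nk _; rewrite ler_piMr // ltW.
have d0 : 0 <= c * k / (k - 1) ^+ 2 * (k - N).
  by rewrite mulr_ge0 ?subr_ge0 // divr_ge0 ?sqr_ge0 // mulr_ge0 // ltW.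
(* If [M] exceeds [k], it exceeds [N] and the claim is immediate. Otherwise |bv|^2 is at most
   [4 * k]; since [1 <= N <= k |v|^2], this bounds [b] itself, as needed for |a| <= 1. *)
have [Mk|/ltW kM] := leP M k; last by lra.
have bv : normsq b * rdot v v <= 4 * k.
  rewrite -rdotZZ; have -> : b *: v = (theta f *m v + b *: v) - theta f *m v.
    by rewrite addrC addKr.
  apply: le_trans (rdot_sub_le _ _) _; rewrite -/N -/M; lra.
have b0 := normsq_ge0 b.
have bk : normsq b <= 4 * k ^+ 2.
  have : normsq b * 1 <= normsq b * (k * rdot v v) by rewrite ler_wpM2l //; lra.
  have := ler_wpM2l (ltW k0) bv; lra.
have bN : normsq b <= k * (normsq b * rdot v v).
  have : normsq b * 1 <= normsq b * (k * rdot v v) by rewrite ler_wpM2l //; lra.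
  lra.
(* For [a = - s b] with this [s], the error term [c |a|^2] of [extremal_ineq]
   is absorbed by [|b|^2 |v|^2]. *)
pose s := (k - 1) / (c * k).
have s0 : 0 < s by rewrite divr_gt0 // mulr_gt0.
have sE : s * c * k = k - 1 by rewrite /s; field; rewrite !gt_eqF.
(* As |b| <= 2k, this gives |a| = s|b| <= 1; it amounts to [2 * (k - 1) <= c]. *)
have sk : 2 * k * s <= 1.
  rewrite -(ler_pM2l c00).
  have -> : c * (2 * k * s) = 2 * (s * c * k) by ring.
  by rewrite sE; lra.
have a1 : normsq (- (s%:C%C * b)) <= 1.
  have -> : normsq (- (s%:C%C * b)) = s ^+ 2 * normsq b.
    by rewrite -normsq_real -normsqM; case: (_ * b) => x y; rewrite /normsq /=; ring.
  have : s ^+ 2 * normsq b <= s ^+ 2 * (4 * k ^+ 2) by rewrite ler_wpM2l ?sqr_ge0.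
  have : (2 * k * s) ^+ 2 <= 1 by rewrite exprn_ile1 // mulr_ge0 ?ltW // mulr_gt0.
  lra.
have := extremal_ineq Af f1 v1 a1.
have -> : normsq (- (s%:C%C * b)) = s ^+ 2 * normsq b.
  by rewrite -normsq_real -normsqM; case: (_ * b) => x y; rewrite /normsq /=; ring.
rewrite scaleNr -scalerA rdotNr rdotZr_real -/N => H.
have ME : M = N + 2 * rdot (theta f *m v) (b *: v) + normsq b * rdot v v.
  by rewrite /M rdot_sqD rdotZZ.
set p := rdot (theta f *m v) (b *: v) in H ME.
have e1 : c * k / (k - 1) ^+ 2 = ((k - 1) * s)^-1.
  by rewrite /s; field; rewrite !gt_eqF.
have e2 : c * (s ^+ 2 * normsq b) <= (k - 1) * s * (normsq b * rdot v v).
  have -> : (k - 1) * s * (normsq b * rdot v v)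
      = c * s ^+ 2 * (k * (normsq b * rdot v v)).
    by rewrite -sE; ring.
  by rewrite mulrA ler_wpM2l // mulr_ge0 ?sqr_ge0 // ltW.
have ks0 : 0 < (k - 1) * s by rewrite mulr_gt0.
(* Multiplied by [(k - 1) * s], the claim is the sum of [H] and [e2]. *)
rewrite ME e1 -(ler_pM2l ks0).
have -> : (k - 1) * s * (N - ((k - 1) * s)^-1 * (k - N))
    = (k - 1) * s * N - (k - N).
  by field; rewrite !gt_eqF.
lra.
Qed.

End Homomorphism.

(** * Contradiction from a nearly extremal pair *)

Unset Implicit Arguments.

Theorem theorem4p1 (R : realType) (X : topologicalType) (A : set (X -> R[i]))
  (n : nat) (theta : (X -> R[i]) -> 'M[R[i]]_n) :
  uniform_algebra A ->
  unital_hom A theta ->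
  mx_continuous_on A theta ->
  (1%:E < mapnorm A theta)%E ->
  forall beta : (X -> R[i]) -> R[i], cont_lin_functional A beta ->
    (mapnorm A theta <= mapnorm A (fun f => (theta f + beta f *: 1%:M)%R))%E.

Proof.
move=> algA homt contt normt beta _; set Phi := fun f => _.
have := mapnorm_lty algA homt contt.
case normK : (mapnorm A theta) normt => [K| |] //; rewrite lte_fin => K1 _.
have K0 : 0 < K by lra.
have k1 : 1 < K ^+ 2 by rewrite exprn_egt1.
rewrite leNgt; apply/negP => PhiK.
(* This excludes the value -oo and lets [L] and [K] be compared through their squares. *)
have : (0%:E <= mapnorm A Phi)%E.
  have z1 : vnorm (0 : 'cV[R[i]]_n) <= 1 by rewrite vnorm_le // rdotr0 expr1n.
  have c1 : (supnorm (fun _ : X => (0 : R[i])%R) <= 1%:E)%E.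
    by apply/supnorm_le => x; rewrite cmod_le // expr1n /normsq /= expr0n /= addr0.
  by apply: le_trans (mapnorm_ub Phi (algC algA 0%R) c1 z1); rewrite lee_fin vnorm_ge0.
case L0 : (mapnorm A Phi) PhiK => [L| |] //; rewrite lte_fin lee_fin => LK L_ge0.
pose d := (K ^+ 2 ^+ 3 + 11 * K ^+ 2 ^+ 2 + 15 * K ^+ 2 + 4) * K ^+ 2
  / (K ^+ 2 - 1) ^+ 2.
have d0 : 0 <= d.
  rewrite divr_ge0 ?sqr_ge0 // mulr_ge0 ?sqr_ge0 //.
  have := sqr_ge0 (K ^+ 2); have := exprn_ge0 3 (sqr_ge0 K); lra.
have LK2 : L ^+ 2 < K ^+ 2 by rewrite ltr_sqr ?nnegrE // ltW.
(* The solution [N] of [N - d * (K ^+ 2 - N) = L ^+ 2]: once |Tv|^2 exceeds [m], the lower bound of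
   [perturbed_ge] exceeds [L ^+ 2]. *)
pose m := (L ^+ 2 + d * K ^+ 2) / (1 + d).
have d1 : 0 < 1 + d by lra.
have m0 : 0 <= m by rewrite divr_ge0 ?(ltW d1) // addr_ge0 ?sqr_ge0 // mulr_ge0 ?sqr_ge0.
have mK : m < K ^+ 2 by rewrite ltr_pdivrMr //; lra.
(* The maximum with 1 secures the hypothesis [1 <= |Tv|^2] of [perturbed_ge]; it stays below
   [K ^+ 2] because [K > 1]. *)
have max0 : 0 <= Num.max 1 m by rewrite le_max ler01.
have maxK : ((Num.sqrt (Num.max 1 m))%:E < mapnorm A theta)%E.
  rewrite normK lte_fin -ltr_sqr ?nnegrE ?sqrtr_ge0 ?(ltW K0) //.
  by rewrite sqr_sqrtr // gt_max k1.
have [f [v [Af f1 v1]]] := mapnorm_gt maxK.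
rewrite lte_fin vnorm_lt ?sqrtr_ge0 // sqr_sqrtr // gt_max => /andP[/ltW N1 mN].
have := perturbed_ge algA homt normK (beta f) k1 Af f1 v1 N1.
rewrite -/d.
have := mapnorm_ub Phi Af f1 v1.
rewrite L0 lee_fin vnorm_le // /Phi mulmxDl -scalemxAl mul1mx => ML.
move: mN; rewrite ltr_pdivrMr //; lra.
Qed.
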